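(* Let $\alpha=[0;a_1,a_2,\dots]$ be an irrational number whose sequence of partial quotients $(a_n)$ is unbounded, and let $(q_n)$ be the sequence of denominators of the convergents of the regular continued fraction of $\alpha$. Then $t^s_{(q_n)}(\mathbb{T})\supsetneq t_{(q_n)}(\mathbb{T})$.
   Context: $\mathbb{T}=\mathbb{R}/\mathbb{Z}$ is the circle group, and for $x\in\mathbb{T}$, $\|x\|$ denotes the distance of (any representative of) $x$ to the nearest integer. $\alpha=[0;a_1,a_2,\dots]$ denotes the regular continued fraction of an irrational $\alpha\in(0,1)$, with convergents $\frac{p_n}{q_n}=[0;a_1,\dots,a_n]$ in lowest terms, $q_n>0$. For $A\subset\mathbb{N}$, the natural density is $d(A)=\lim_{n\to\infty}\frac{|A\cap[1,n]|}{n}$ when this limit exists. For a sequence of integers $(u_n)$, the characterized subgroup is $$t_{(u_n)}(\mathbb{T})=\{x\in\mathbb{T}: u_nx\to 0\text{ in }\mathbb{T}\},$$ and the statistically characterized subgroup is $$t^s_{(u_n)}(\mathbb{T})=\{x\in\mathbb{T}: \forall\varepsilon>0,\ d(\{n\in\mathbb{N}:\|u_nx\|\ge\varepsilon\})=0\}.$$ *)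

(* Defs.v *)
From HB Require Import structures.
From mathcomp Require Import all_boot all_order all_algebra.
From mathcomp Require Import archimedean ring_quotient.
From mathcomp Require Import all_classical all_reals all_analysis.

Set Implicit Arguments.
Unset Strict Implicit.
Unset Printing Implicit Defensive.

Import Order.TTheory GRing.Theory Num.Theory.
Import numFieldNormedType.Exports.

Local Open Scope classical_set_scope.
Local Open Scope ring_scope.
Local Open Scope quotient_scope.

Section Integers.
Context {R : realType}.

Definition integers : {pred R} := [pred x | x \is a Num.int].

Lemma integers_zmod_closed : zmod_closed integers.
Proof.
by split=> [|x y]; rewrite !inE; [exact: int_num0 | exact: rpredB].
Qed.

HB.instance Definition _ :=
  GRing.isZmodClosed.Build R integers integers_zmod_closed.

End Integers.

Definition circle (R : realType) : Type := Quotient.quot (@integers R).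

Section Circle.
Context {R : realType}.
Local Notation T := (circle R).

HB.instance Definition _ := GRing.Zmodule.on T.
HB.instance Definition _ := EqQuotient.on T.

(* These are the open sets of the library's [quotient_topology], whose instance
   cannot be copied onto [circle R]: it comes with its own choice structure,
   different from that of the quotient group. *)
Definition circle_open (U : set T) : Prop :=
  quotient_open (Q0 := Quotient.quot (@integers R)) U.

Lemma circle_openT : circle_open setT.
Proof. by rewrite /circle_open /quotient_open preimage_setT; exact: openT. Qed.

Lemma circle_openI : setI_closed circle_open.
Proof. by move=> U V oU oV; exact: openI oU oV. Qed.

Lemma circle_open_bigU (I : Type) (f : I -> set T) :
  (forall i, circle_open (f i)) -> circle_open (\bigcup_i f i).
Proof. by move=> fo; apply: bigcup_open => i _; exact: fo. Qed.

HB.instance Definition _ := isOpenTopological.Build T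
  circle_openT circle_openI circle_open_bigU.

Definition dist_nearest_int (x : R) : R :=
  inf [set `|x - k%:~R| | k in [set: int]].

Definition circle_norm (x : T) : R := dist_nearest_int (repr x).

Lemma circle_norm_pi (x : R) : circle_norm (\pi_T x) = dist_nearest_int x.
Proof.
have /intrP[m xm] : x - repr (\pi_T x) \is a Num.int.
  by have := Quotient.idealrBE (@integers R) x (repr (\pi_T x));
    rewrite reprK eqxx inE.
have {}xm : x = repr (\pi_T x) + m%:~R by rewrite -xm addrC subrK.
rewrite /circle_norm /dist_nearest_int; congr (inf _).
apply/seteqP; split=> _ [k _ <-] /=.
  by exists (k + m) => //; rewrite [X in `|X - _|]xm intrD opprD addrACA subrr addr0.
exists (k - m) => //; rewrite [X in _ = `|X - _|]xm intrB.
by rewrite opprB addrA.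
Qed.

End Circle.

Definition natural_density {R : realType} (A : set nat) (d : R) : Prop :=
  (count (fun k => k \in A) (iota 1 n))%:R / n%:R @[n --> \oo] --> d.

Definition char_subgroup (R : realType) (u : nat -> int) : set (circle R) :=
  [set x | (x *~ u n) @[n --> \oo] --> (0 : circle R)].

Definition stat_char_subgroup (R : realType) (u : nat -> int) :
    set (circle R) :=
  [set x | forall eps : R, 0 < eps ->
     natural_density [set n | eps <= circle_norm (x *~ u n)] (0 : R)].

Arguments char_subgroup : clear implicits.
Arguments stat_char_subgroup : clear implicits.

Section ContinuedFraction.
Context {R : realType}.
Implicit Types (alpha : R) (n : nat).

Definition complete_quotient alpha n : R :=
  iter n (fun x => (x - (Num.floor x)%:~R)^-1) alpha.

Definition partial_quotient alpha n : int :=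
  Num.floor (complete_quotient alpha n).

Fixpoint finite_cfrac (a0 : int) (s : seq int) : rat :=
  a0%:~R + (if s is a1 :: s' then (finite_cfrac a1 s')^-1 else 0).

Definition convergent alpha n : rat :=
  finite_cfrac (partial_quotient alpha 0)
    [seq partial_quotient alpha k | k <- iota 1 n].

Definition convergent_den alpha n : int := denq (convergent alpha n).

End ContinuedFraction.

(* Main.v *)
(* Let D_n = q_n alpha - p_n.  Choose a sparse sequence n_k of indices with
   a_(n_k + 1) >= 2, so that q_(n_k) |D_(n_k)| <= 1/2, and integers c_k with
   1/4 <= c_k q_(n_k) |D_(n_k)| <= 1/2; put x = sum_k c_k D_(n_k).  As q_n at
   least doubles and |D_n| at least halves every two steps, and as q_m D_n and
   q_n D_m agree modulo 1, || q_m x || <= sum_k r^|m - n_k| with r = 3/4.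
   Summing over m <= M shows that the average of || q_m x || tends to 0, hence
   x is in the statistically characterized subgroup (Markov's inequality), while
   || q_m x || >= 1/8 at m = n_k, where the k-th term dominates. *)

Require Import Defs.
From mathcomp Require Import all_boot all_order all_algebra.
From mathcomp Require Import archimedean ring_quotient zify ring lra.
From mathcomp Require Import all_classical all_reals all_analysis.

Set Implicit Arguments.
Unset Strict Implicit.
Unset Printing Implicit Defensive.

Import Order.TTheory GRing.Theory Num.Theory.
Import numFieldNormedType.Exports.

Local Open Scope classical_set_scope.
Local Open Scope ring_scope.
Local Open Scope quotient_scope.

(** * Continued fractions *)

(** Peels off the first quotient without division: if the tail equals p/q, then a0 + q/p = (a0 p +
    q)/p. *)
Fixpoint cfrac_pair (a0 : int) (s : seq int) : int * int :=
  if s is a1 :: s' then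
    let: (p, q) := cfrac_pair a1 s' in (a0 * p + q, p)
  else (a0, 1).

Lemma cfrac_pair_gt0 (a0 : int) (s : seq int) :
  0 < a0 -> all (fun a => 0 < a) s ->
  0 < (cfrac_pair a0 s).1 /\ 0 < (cfrac_pair a0 s).2.
Proof.
elim: s a0 => [|a1 s IHs] a0 a0_gt0 //= /andP[a1_gt0 s_gt0].
have [] := IHs a1 a1_gt0 s_gt0.
by case: (cfrac_pair a1 s) => p q /= p_gt0 q_gt0; split; nia.
Qed.

(** The step from (p, q) to (a0 p + q, p) preserves coprimality, and p is positive, so the pair is
    already in lowest terms. The sign of [a0] is free, since only numerators of tails become
    denominators. *)
Lemma denq_finite_cfrac (a0 : int) (s : seq int) :
  all (fun a => 0 < a) s -> denq (finite_cfrac a0 s) = (cfrac_pair a0 s).2.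
Proof.
move=> s_gt0.
have [H1 H2 H3] : [/\ finite_cfrac a0 s =
      (cfrac_pair a0 s).1%:~R / (cfrac_pair a0 s).2%:~R,
      coprimez (cfrac_pair a0 s).1 (cfrac_pair a0 s).2
    & 0 < (cfrac_pair a0 s).2].
  elim: s a0 s_gt0 => [|a1 s IHs] a0 /=.
    by rewrite addr0 divr1 /coprimez gcdz1.
  move=> /andP[a1_gt0 s_gt0]; have [] := IHs a1 s_gt0.
  have [] := cfrac_pair_gt0 a1_gt0 s_gt0.
  case: (cfrac_pair a1 s) => p q /= p_gt0 q_gt0 -> cpq _; split=> //.
    have p0 : p%:~R != 0 :> rat by rewrite intr_eq0 gt_eqF.
    by rewrite intrD intrM; field; rewrite p0 intr_eq0 gt_eqF.
  by rewrite /coprimez gcdzC gcdzMDl; rewrite /coprimez in cpq.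
rewrite H1 coprimeq_den; last by rewrite -coprimezE.
by rewrite gt_eqF// gtr0_norm.
Qed.

(** Links two directions of recursion: [cfrac_pair] consumes quotients from the front, the
    three-term recurrence from the back. *)
Lemma linear_recurrence_cfrac (a u : nat -> int) :
  (forall j, u j.+2 = a j * u j.+1 + u j) ->
  forall l i, let: (p, q) := cfrac_pair (a i) [seq a k | k <- iota i.+1 l] in
    u (i + l).+2 = p * u i.+1 + q * u i.
Proof.
move=> urec; elim=> [|l IHl] i /=; first by rewrite addn0 urec mul1r.
have := IHl i.+1; case: (cfrac_pair _ _) => p q.
rewrite addnS -addSn => ->; rewrite urec; ring.
Qed.

Section Convergents.
Variable (a : nat -> int).

(* Indices are shifted by two: the recurrence starts from p_(-2), p_(-1) and
   from q_(-2), q_(-1), so [shifted_num n.+2] is p_n. *)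
Fixpoint shifted_num (n : nat) : int :=
  match n with
  | 0 => 0
  | 1 => 1
  | (m.+1 as m1).+1 => a m * shifted_num m1 + shifted_num m
  end.

Fixpoint shifted_den (n : nat) : int :=
  match n with
  | 0 => 1
  | 1 => 0
  | (m.+1 as m1).+1 => a m * shifted_den m1 + shifted_den m
  end.

Lemma shifted_numS n :
  shifted_num n.+2 = a n * shifted_num n.+1 + shifted_num n.
Proof. by []. Qed.

Lemma shifted_denS n :
  shifted_den n.+2 = a n * shifted_den n.+1 + shifted_den n.
Proof. by []. Qed.

Hypothesis a_gt0 : forall n, 0 < a n.+1.

Lemma denq_cfrac n :
  denq (finite_cfrac (a 0%N) [seq a k | k <- iota 1 n]) = shifted_den n.+2.
Proof.
rewrite denq_finite_cfrac; last first.
  apply/allP => _ /mapP[k + ->]; rewrite mem_iota => /andP[k_gt0 _].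
  by rewrite -(prednK k_gt0).
(* The initial values 1 and 0 of [shifted_den] select the second component of the pair. *)
have := linear_recurrence_cfrac shifted_denS n 0.
case: (cfrac_pair _ _) => p q; rewrite add0n => -> /=.
by rewrite mulr0 mulr1 add0r.
Qed.

Lemma shifted_den_gt0 n : 0 < shifted_den n.+2.
Proof.
suff [] : 0 < shifted_den n.+2 /\ 0 <= shifted_den n.+1 by [].
elim: n => [|n [IH1 IH2]]; first by rewrite /= mulr0.
split; last exact: ltW.
by rewrite shifted_denS ltr_wpDr// mulr_gt0.
Qed.

Lemma shifted_den_ge0 n : 0 <= shifted_den n.
Proof. by case: n => [|[|n]] //; exact/ltW/shifted_den_gt0. Qed.

Lemma shifted_den_nondecr n : shifted_den n.+2 <= shifted_den n.+3.
Proof.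
have := shifted_den_gt0 n; have := a_gt0 n; have := shifted_den_ge0 n.+1.
rewrite (shifted_denS n.+1); nia.
Qed.

Lemma shifted_den_double n : 2 * shifted_den n.+2 <= shifted_den n.+4.
Proof.
have := shifted_den_nondecr n; have := a_gt0 n.+1; have := shifted_den_gt0 n.
rewrite (shifted_denS n.+2); nia.
Qed.

End Convergents.

(** * Approximation errors of the convergents *)

Section Approximation.
Context {R : realType} (alpha : R).
Hypothesis alpha_irrational : irrational alpha.

Local Notation cq := (complete_quotient alpha).
Local Notation a := (partial_quotient alpha).
Local Notation u := (shifted_num a).
Local Notation v := (shifted_den a).

(** Under the shift by two, [shifted_err n.+2] is D_n; the two values before D_0 are alpha and
    -1. *)
Definition shifted_err n : R := (v n)%:~R * alpha - (u n)%:~R.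
Local Notation w := shifted_err.

Lemma complete_quotientS n : cq n.+1 = (cq n - (a n)%:~R)^-1.
Proof. by []. Qed.

Lemma complete_quotient_irrational n : irrational (cq n).
Proof.
elim: n => // n IHn [q _ qE]; apply: IHn; exists ((a n)%:~R + q^-1) => //.
rewrite rmorphD/= ratr_int fmorphV/= qE complete_quotientS invrK.
by rewrite addrC subrK.
Qed.

Lemma complete_quotient_frac n : 0 < cq n - (a n)%:~R < 1.
Proof.
have /andP[le_a lt_a] := floor_itv (cq n).
rewrite ltrBlDl -(intrD _ _ 1) lt_a andbT subr_gt0 lt_neqAle le_a andbT.
apply/eqP => E; apply: (@complete_quotient_irrational n).
by exists (a n)%:~R => //; rewrite ratr_int.
Qed.

Lemma complete_quotient_gt1 n : 1 < cq n.+1.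
Proof.
have /andP[gt0 lt1] := complete_quotient_frac n.
by rewrite complete_quotientS invf_gt1.
Qed.

Lemma partial_quotient_gt0 n : 0 < a n.+1.
Proof.
rewrite gtz0_ge1 /partial_quotient floor_ge_int.
exact/ltW/complete_quotient_gt1.
Qed.

Lemma convergent_denE n : convergent_den alpha n = v n.+2.
Proof. exact: denq_cfrac partial_quotient_gt0 n. Qed.

Lemma shifted_errS n : w n.+2 = (a n)%:~R * w n.+1 + w n.
Proof. rewrite /w shifted_numS shifted_denS !intrD !intrM; ring. Qed.

(** By the recurrence and induction, w (n+2) = (a_n - cq n) w (n+1), where a_n - cq n = -1 / cq
    (n+1). *)
Lemma shifted_errE n : w n = - cq n * w n.+1.
Proof.
elim: n => [|n IHn]; first by rewrite /w /=; ring.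
have /andP[gt0 _] := complete_quotient_frac n.
by rewrite shifted_errS IHn complete_quotientS; field; rewrite gt_eqF.
Qed.

Lemma norm_shifted_errE n : `|w n.+1| = cq n.+1 * `|w n.+2|.
Proof.
rewrite {1}shifted_errE normrM normrN (@gtr0_norm _ (cq _))//.
exact: lt_trans ltr01 (complete_quotient_gt1 n).
Qed.

(** The determinant of consecutive convergents is 1 up to sign; here it is written with errors, and
    [w n] is eliminated through [shifted_errE]. *)
Lemma shifted_err_det n :
  `|(cq n * (v n.+1)%:~R + (v n)%:~R) * w n.+1| = 1.
Proof.
suff det : `|(v n.+1)%:~R * w n - (v n)%:~R * w n.+1| = 1.
  rewrite -[RHS]det -normrN (shifted_errE n); congr (`|_|); ring.
elim: n => [|n IHn].
  by rewrite -[RHS]normr1 /w /=; congr (`|_|); ring.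
rewrite -[RHS]IHn -normrN shifted_errS shifted_denS intrD intrM.
by congr (`|_|); ring.
Qed.

Lemma shifted_err_neq0 n : w n.+1 != 0.
Proof.
apply/eqP => E; have := shifted_err_det n.
by rewrite E mulr0 normr0 => /esym/eqP; rewrite oner_eq0.
Qed.

(** Two steps divide the error by cq (n+1) cq (n+2) = a_(n+1) cq (n+2) + 1, which exceeds 2. *)
Lemma shifted_err_half n : 2 * `|w n.+3| <= `|w n.+1|.
Proof.
have h1 := complete_quotient_gt1 n.
have h2 := complete_quotient_gt1 n.+1.
have /andP[h3 _] := complete_quotient_frac n.+1.
have ha : (1 : R) <= (a n.+1)%:~R.
  by rewrite -[1]/(1%:~R) ler_int; have := partial_quotient_gt0 n; lia.
rewrite (norm_shifted_errE n) (norm_shifted_errE n.+1).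
rewrite mulrA ler_wpM2r//.
have E : (cq n.+1 - (a n.+1)%:~R) * cq n.+2 = 1.
  by rewrite (complete_quotientS n.+1) divff// gt_eqF.
nra.
Qed.

Lemma shifted_err_nonincr n : `|w n.+2| <= `|w n.+1|.
Proof.
rewrite [leRHS]norm_shifted_errE ler_peMl//; exact/ltW/complete_quotient_gt1.
Qed.

(** [shifted_err_det] bounds the product by 1 / cq (n+1), and a complete quotient is at least its
    floor. *)
Lemma den_mul_err_le n : 2 <= a n.+1 -> (v n.+2)%:~R * `|w n.+2| <= 2^-1.
Proof.
move=> a2; have := shifted_err_det n.+1; rewrite normrM.
have v0 : 0 < (v n.+2)%:~R :> R.
  by rewrite ltr0z; exact: shifted_den_gt0 partial_quotient_gt0 n.
have v1 : 0 <= (v n.+1)%:~R :> R.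
  by rewrite ler0z; exact: shifted_den_ge0 partial_quotient_gt0 n.+1.
have /andP[c0 _] := complete_quotient_frac n.+1.
have c2 : 2 <= cq n.+1 by move: a2; rewrite -(ler_int R); lra.
rewrite ger0_norm; last by nra.
have := normr_ge0 (w n.+2); nra.
Qed.

End Approximation.

(** * Distance to the nearest integer *)

Section DistNearestInt.
Context {R : realType}.
Implicit Types (x y : R) (k : int).

Lemma dist_nearest_int_lbound x :
  lbound [set `|x - k%:~R| | k in [set: int]] 0.
Proof. by move=> _ [k _ <-]. Qed.

Lemma dist_nearest_int_le x k : dist_nearest_int x <= `|x - k%:~R|.
Proof.
by apply: ge_inf; [exists 0; exact: dist_nearest_int_lbound|exists k].
Qed.

Lemma le_dist_nearest_int x y :
  (forall k, y <= `|x - k%:~R|) -> y <= dist_nearest_int x.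
Proof.
move=> H; apply: lb_le_inf; first by exists `|x - 0%:~R|, 0.
by move=> _ [k _ <-].
Qed.

Lemma dist_nearest_int_ge0 x : 0 <= dist_nearest_int x.
Proof. exact: le_dist_nearest_int. Qed.

Lemma dist_nearest_int_le_norm x : dist_nearest_int x <= `|x|.
Proof. by have := dist_nearest_int_le x 0; rewrite subr0. Qed.

Lemma dist_nearest_intN x : dist_nearest_int (- x) = dist_nearest_int x.
Proof.
suff H y : dist_nearest_int (- y) <= dist_nearest_int y.
  by apply/eqP; rewrite eq_le H -{1}[x]opprK H.
apply: le_dist_nearest_int => k.
by have := dist_nearest_int_le (- y) (- k); rewrite intrN opprK addrC distrC.
Qed.

(** The free integer [k] covers both uses: Lipschitz continuity for k = 0, and invariance modulo 1
    when x - y = k. *)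
Lemma dist_nearest_int_trans x y k :
  dist_nearest_int x <= dist_nearest_int y + `|x - y - k%:~R|.
Proof.
rewrite -lerBlDr; apply: le_dist_nearest_int => l; rewrite lerBlDr.
apply: le_trans (dist_nearest_int_le x (k + l)) _.
have -> : x - (k + l)%:~R = (y - l%:~R) + (x - y - k%:~R).
  by rewrite intrD; ring.
exact: ler_normD.
Qed.

Lemma dist_nearest_intD x y :
  dist_nearest_int (x + y) <= dist_nearest_int x + dist_nearest_int y.
Proof.
rewrite -lerBlDl; apply: le_dist_nearest_int => k.
rewrite lerBlDl (le_trans (dist_nearest_int_trans _ x k))//.
by rewrite [x + y]addrC addrK.
Qed.

Lemma dist_nearest_int_sum (I : Type) (s : seq I) (P : pred I) (f : I -> R) :
  dist_nearest_int (\sum_(i <- s | P i) f i) <=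
  \sum_(i <- s | P i) dist_nearest_int (f i).
Proof.
elim/big_ind2: _ => //.
  by apply: le_trans (dist_nearest_int_le_norm 0) _; rewrite normr0.
move=> x1 y1 x2 y2 h1 h2.
by apply: le_trans (dist_nearest_intD _ _) _; exact: lerD.
Qed.

Lemma dist_nearest_int_small x :
  `|x| <= 2^-1 -> dist_nearest_int x = `|x|.
Proof.
move=> x_le; apply/eqP; rewrite eq_le dist_nearest_int_le_norm /=.
apply: le_dist_nearest_int => k.
have [->|k0] := eqVneq k 0; first by rewrite subr0.
have k1 : 1 <= `|k%:~R| :> R.
  by rewrite -intr_norm -[1]/(1%:~R) ler_int; lia.
have := lerB_dist k%:~R x; rewrite distrC; lra.
Qed.

Lemma circle_norm_ge0 (x : circle R) : 0 <= circle_norm x.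
Proof. exact: dist_nearest_int_ge0. Qed.

Lemma circle_norm_piMz x k :
  circle_norm ((\pi_(circle R) x) *~ k) = dist_nearest_int (x *~ k).
Proof.
rewrite -circle_norm_pi; congr circle_norm.
by rewrite -(raddfMz (\pi_(Quotient.quot (@integers R)))).
Qed.

Lemma circle_norm0 : circle_norm (0 : circle R) = 0.
Proof.
apply/eqP; rewrite eq_le circle_norm_ge0 andbT.
have -> : (0 : circle R) = \pi_(circle R) 0.
  by rewrite -(raddf0 (\pi_(Quotient.quot (@integers R)))).
by rewrite circle_norm_pi (le_trans (dist_nearest_int_le_norm 0))// normr0.
Qed.

Lemma circle_norm_lt_open (e : R) : open [set x : circle R | circle_norm x < e].
Proof.
(* A set is open in the circle when its preimage in R is; there the distance is 1-Lipschitz. *)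
suff : open [set x : R | dist_nearest_int x < e].
  congr open; apply/seteqP; split=> x /=; by rewrite -circle_norm_pi.
rewrite openE => x /= xe; apply/nbhs_ballP.
exists (e - dist_nearest_int x) => /=; first by rewrite subr_gt0.
move=> y; rewrite /ball/= distrC => xy.
have := dist_nearest_int_trans y x 0; rewrite subr0; lra.
Qed.

Lemma circle_norm_cvg0 (x : nat -> circle R) (e : R) : 0 < e ->
  x n @[n --> \oo] --> (0 : circle R) ->
  \forall n \near \oo, circle_norm (x n) < e.
Proof.
move=> e0 /(_ [set y | circle_norm y < e]); apply.
apply: open_nbhs_nbhs; split; first exact: circle_norm_lt_open.
by rewrite /= circle_norm0.
Qed.

End DistNearestInt.

(** * Density zero *)

Section Density.
Context {R : realType}.
Implicit Types (A : set nat).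

Lemma natural_density0P A :
  (forall e : R, 0 < e -> \forall n \near \oo,
     (count (fun k => k \in A) (iota 1 n))%:R <= e * n%:R) ->
  natural_density A (0 : R).
Proof.
move=> H; apply/cvgrPdist_le => e e0; near=> n.
have n0 : 0 < n%:R :> R by rewrite ltr0n; near: n; exact: nbhs_infty_gt.
rewrite sub0r normrN ger0_norm; last by rewrite divr_ge0.
by rewrite ler_pdivrMr//; near: n; exact: H.
Unshelve. all: by end_near. Qed.

Lemma natural_density_finite A :
  (\forall n \near \oo, ~ A n) -> natural_density A (0 : R).
Proof.
move=> [N _ HN]; apply: natural_density0P => e e0.
have cN n : (count (fun k => k \in A) (iota 1 n) <= N)%N.
  have [nN|Nn] := leqP n N.
    by rewrite (leq_trans (count_size _ _))// size_iota.
  rewrite -(subnKC Nn) addSnnS iotaD count_cat.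
  rewrite [X in (_ + X)%N](_ : _ = 0)%N ?addn0; last first.
    apply/eqP; rewrite -leqn0 leqNgt -has_count; apply/hasPn => k.
    rewrite mem_iota => /andP[Nk _]; apply/negP; rewrite inE.
    by apply: HN => /=; lia.
  by rewrite (leq_trans (count_size _ _))// size_iota.
near=> n; apply: (@le_trans _ _ N%:R); first by rewrite ler_nat.
rewrite mulrC -ler_pdivrMr//; apply: ltW; near: n; exact: nbhs_infty_gtr.
Unshelve. all: by end_near. Qed.

(** Counts of order sqrt n are o(n); quantifying over [k] with n <= k^2 avoids real square roots. *)
Lemma natural_density_sqrt A (C : R) :
  (forall n k : nat, (n <= k ^ 2)%N ->
     (count (fun i => i \in A) (iota 1 n))%:R <= C * k.+1%:R) ->
  natural_density A (0 : R).
Proof.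
move=> HC; apply: natural_density0P => e e0.
have C0 : 0 <= C by have := HC 0 0 isT; rewrite /= mulr1.
(* With k close to n / L, this [L] keeps the part of C (k + 1) that is linear in n below e n / 2. *)
pose L := (Num.bound (2 * C / e)).+1.
have CL : C <= e / 2 * L%:R.
  have : 2 * C / e < L%:R.
    have C0' : 0 <= 2 * C / e by rewrite divr_ge0// ?mulr_ge0// ltW.
    by rewrite (lt_trans (archi_boundP C0'))// ltr_nat.
  rewrite ltr_pdivrMr//; lra.
near=> n.
have nC : C * (2 + L%:R) <= e / 2 * n%:R.
  rewrite [leRHS]mulrC -ler_pdivrMr ?divr_gt0//; apply: ltW.
  near: n; exact: nbhs_infty_gtr.
(* The product of [n %/ L + 1] and [L] already exceeds n. *)
have nk : (n <= (n %/ L + 1 + L) ^ 2)%N.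
  have := divn_eq n L; have : (n %% L < L)%N by rewrite ltn_mod.
  by nia.
have /le_trans := HC _ _ nk; apply.
have : (n %/ L)%:R * L%:R <= n%:R :> R by rewrite -natrM ler_nat leq_divM.
have : 0 <= (n %/ L)%:R :> R by [].
rewrite -addn1 !natrD; nra.
Unshelve. all: by end_near. Qed.

Lemma count_markov (I : Type) (s : seq I) (P : pred I) (f : I -> R) (e : R) :
  (forall i, 0 <= f i) -> (forall i, P i -> e <= f i) ->
  e * (count P s)%:R <= \sum_(i <- s) f i.
Proof.
move=> f0 Pf; elim: s => [|i s IHs] /=; first by rewrite mulr0 big_nil.
rewrite big_cons natrD mulrDr lerD//.
by case: (boolP (P i)) => Pi; rewrite /= ?mulr1 ?mulr0// Pf.
Qed.

End Density.

(** * Sparse series of approximation errors *)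

(* The absolute difference |m - n|. *)
Definition gap (m n : nat) : nat := (m - n + (n - m))%N.

Lemma gapC m n : gap m n = gap n m. Proof. exact: addnC. Qed.

(** The two-sided geometric series sums to (1 + s) / (1 - s); clearing the denominator also admits s
    = 1. *)
Lemma sum_expr_gap (R : realFieldType) (s : R) (j K : nat) : 0 <= s <= 1 ->
  (1 - s) * \sum_(k < K) s ^+ gap j k <= 1 + s.
Proof.
move=> /andP[s0 s1].
have pow0 d : 0 <= s ^+ d by rewrite exprn_ge0.
(* Form suited to induction on [K]: the exact value of the partial sum without its term -s^(j+1),
   before and after [K] passes [j]. *)
suff : (1 - s) * \sum_(k < K) s ^+ gap j k <=
    if (K <= j)%N then s ^+ (j.+1 - K) else 1 + s - s ^+ (K - j).
  case: ifP => [Kj|_] /le_trans; apply; last by have := pow0 (K - j)%N; lra.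
  rewrite subSn// exprS; have : s ^+ (j - K) <= 1 by rewrite exprn_ile1.
  by have := pow0 (j - K)%N; nra.
elim: K => [|K IHK]; first by rewrite big_ord0 mulr0 leq0n.
rewrite big_ord_recr /= mulrDr.
case: (ltngtP K j) IHK => [Kj|jK|->] IHK.
- rewrite subSS; have -> : gap j K = (j - K)%N by rewrite /gap; lia.
  by move: IHK; rewrite subSn 1?ltnW// exprS; lra.
- rewrite subSn 1?ltnW// exprS.
  have -> : gap j K = (K - j)%N by rewrite /gap; lia.
  by move: IHK; lra.
- move: IHK; rewrite subSnn /gap subnn expr0 !expr1; lra.
Qed.

Lemma exists_sparse_seq (P : nat -> Prop) (G : nat) :
  (forall N, exists2 n, (N <= n)%N & P n) ->
  exists n : nat -> nat, [/\ forall k, P (n k), forall k, (k ^ 2 <= n k)%N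
    & forall j k, (G * gap j k <= gap (n j) (n k))%N].
Proof.
move=> infP; have : forall N, exists n, (N <= n)%N /\ P n.
  by move=> N; have [n ? ?] := infP N; exists n.
move=> /choice[f fP].
(* The increment 2k + 1 is the difference of consecutive squares and yields k^2 <= n k; [G] yields
   the linear separation. *)
have [n nS Pn] : exists2 n : nat -> nat,
    forall k, (n k + 2 * k + 1 + G <= n k.+1)%N & forall k, P (n k).
  pose n := fix n k := if k is j.+1 then f (n j + 2 * j + 1 + G)%N else f 0.
  exists n => [k|[|k]]; first by have [] := fP (n k + 2 * k + 1 + G)%N.
    by have [] := fP 0.
  by have [] := fP (n k + 2 * k + 1 + G)%N.
have nG j d : (n j + G * d <= n (j + d))%N.
  elim: d => [|d IHd]; first by rewrite muln0 !addn0.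
  by have := nS (j + d)%N; rewrite (addnS j d) mulnS; lia.
exists n; split.
- exact: Pn.
- elim=> [|k IHk] //; have := nS k; lia.
- move=> j k; have [jk|/ltnW kj] := leqP j k.
    by have := nG j (k - j)%N; rewrite subnKC// /gap; nia.
  by have := nG k (j - k)%N; rewrite subnKC// /gap; nia.
Qed.

(** The rate 3/4 is a rational above sqrt(1/2), as 9/16 > 1/2. The factor 2 absorbs the first step,
    and the induction carries two consecutive bounds. *)
Lemma geometric_decay (R : realFieldType) (f : nat -> R) (m d : nat) :
  (forall n, 0 <= f n) -> (forall n, f n.+1 <= f n) ->
  (forall n, 2 * f n.+2 <= f n) -> f (m + d)%N <= 2 * (3 / 4) ^+ d * f m.
Proof.
move=> f0 f1 f2.
suff [] : f (m + d)%N <= 2 * (3 / 4) ^+ d * f m /\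
  f (m + d.+1)%N <= 2 * (3 / 4) ^+ d.+1 * f m by [].
elim: d => [|d [IH1 IH2]].
  by rewrite addn0 addn1 expr0 expr1; have := f0 m; have := f1 m; lra.
split=> //; have := f2 (m + d)%N; rewrite !addnS !exprS.
have : 0 <= (3 / 4) ^+ d * f m by rewrite mulr_ge0// exprn_ge0//; lra.
by move: IH1; rewrite -!mulrA; lra.
Qed.

(** When x < 1/4, the least multiple reaching 1/4 overshoots by less than 1/4. The bound 1/2 later
    cancels the factor 2 of [geometric_decay]; the bound 1/4 gives the dominant term its size. *)
Lemma exists_multiple (R : realType) (x : R) : 0 < x <= 2^-1 ->
  exists c : nat, 4^-1 <= c%:R * x <= 2^-1.
Proof.
move=> /andP[x0 x2].
have [x4|x4] := lerP 4^-1 x; first by exists 1%N; rewrite mul1r x4 x2.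
have ex : exists c : nat, 4^-1 <= c%:R * x.
  exists (Num.bound (4 * x)^-1).
  have : (4 * x)^-1 < (Num.bound (4 * x)^-1)%:R.
    by apply: archi_boundP; rewrite invr_ge0; lra.
  by rewrite invfM ltr_pdivrMr// => /ltW.
case: (ex_minnP ex) => c c4 cmin; exists c; rewrite c4 /=.
case: c c4 cmin => [|c] c4 cmin; first by move: c4; rewrite mul0r; lra.
rewrite -natr1 mulrDl.
have [/cmin|] := lerP 4^-1 (c%:R * x); [by rewrite ltnn|lra].
Qed.

Section SparseSeries.
Context {R : realType} (alpha : R) (p q : nat -> int).

Local Notation err := (fun n => (q n)%:~R * alpha - (p n)%:~R).

Hypothesis q_gt0 : forall n, 0 < q n.
Hypothesis q_nondecr : forall n, q n <= q n.+1.
Hypothesis q_double : forall n, 2 * q n <= q n.+2.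
Hypothesis err_nonincr : forall n, `|err n.+1| <= `|err n|.
Hypothesis err_half : forall n, 2 * `|err n.+2| <= `|err n|.

Local Notation r := (3 / 4 : R).

Lemma den_decay (m d : nat) :
  (q m)%:~R <= 2 * r ^+ d * (q (m + d)%N)%:~R.
Proof.
have qR n : 0 < (q n)%:~R :> R by rewrite ltr0z.
(* Growth of [q] is decay of its reciprocals. *)
have := @geometric_decay R (fun n => (q n)%:~R^-1) m d.
have -> : ((q (m + d))%:~R^-1 <= 2 * r ^+ d * (q m)%:~R^-1) =
          ((q m)%:~R <= 2 * r ^+ d * (q (m + d)%N)%:~R).
  by rewrite -[RHS]ler_pdivrMr// ler_pdivlMr// mulrC.
apply => n.
- by rewrite invr_ge0 ltW.
- by rewrite lef_pV2 ?posrE// ler_int.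
- rewrite -ler_pdivlMl// -invfM lef_pV2 ?posrE ?mulr_gt0//.
  by rewrite -(intrM _ 2) ler_int.
Qed.

Lemma err_decay (m d : nat) : `|err (m + d)%N| <= 2 * r ^+ d * `|err m|.
Proof. exact: (@geometric_decay R (fun n => `|err n|)). Qed.

(* Swapping [q m] and [q n] in [q m * err n] changes it by an integer, so the
   distance decays on both sides of the diagonal. *)
Lemma dist_den_mul_err (c m n : nat) :
  c%:R * ((q n)%:~R * `|err n|) <= 2^-1 ->
  dist_nearest_int ((q m)%:~R * (c%:R * err n)) <= r ^+ gap m n.
Proof.
move=> c_le.
have qR k : 0 < (q k)%:~R :> R by rewrite ltr0z.
have c0 : 0 <= c%:R :> R by [].
have r0 d : 0 <= r ^+ d by rewrite exprn_ge0//; lra.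
have [mn|nm] := leqP m n.
  apply: le_trans (dist_nearest_int_le_norm _) _.
  rewrite !normrM (ger0_norm (ltW (qR m))) (ger0_norm c0).
  have := den_decay m (n - m); rewrite subnKC//.
  have -> : gap m n = (n - m)%N by rewrite /gap; lia.
  move=> /(ler_wpM2r (mulr_ge0 c0 (normr_ge0 (err n)))) /le_trans; apply.
  have := ler_wpM2l (mulr_ge0 (ler0n R 2) (r0 (n - m)%N)) c_le.
  by lra.
apply: le_trans (dist_nearest_int_trans _ ((q n)%:~R * (c%:R * err m))
   (c%:Z * (q n * p m - q m * p n))) _.
rewrite [X in _ + `|X|](_ : _ = 0) ?normr0 ?addr0; last first.
  by rewrite intrM intrB !intrM; ring.
apply: le_trans (dist_nearest_int_le_norm _) _.
rewrite !normrM (ger0_norm (ltW (qR n))) (ger0_norm c0).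
have := err_decay n (m - n); rewrite subnKC 1?ltnW//.
have -> : gap m n = (m - n)%N by rewrite /gap; lia.
move=> /(ler_wpM2l (mulr_ge0 (ltW (qR n)) c0)).
rewrite -mulrA => /le_trans; apply.
have := ler_wpM2l (mulr_ge0 (ler0n R 2) (r0 (m - n)%N)) c_le.
by lra.
Qed.

Section Witness.
Variables (n c : nat -> nat).
Hypothesis n_sqr : forall k, (k ^ 2 <= n k)%N.
Hypothesis n_gap : forall j k, (16 * gap j k <= gap (n j) (n k))%N.
Hypothesis c_itv : forall k,
  4^-1 <= (c k)%:R * ((q (n k))%:~R * `|err (n k)|) <= 2^-1.

Definition sparse_term k : R := (c k)%:R * err (n k).

Definition sparse_sum : R := limn (series sparse_term).

(** The term is at most 1 / (2 q (n k)), which is at most r^(n k) because q 0 >= 1; then n k >= k^2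
    >= k. *)
Lemma sparse_term_le k : `|sparse_term k| <= r ^+ k.
Proof.
have /andP[_ ck] := c_itv k.
have := den_decay 0 (n k); rewrite add0n => q0.
have q1 : 1 <= (q 0%N)%:~R :> R by rewrite -[1]/(1%:~R) ler_int -gtz0_ge1.
have qR : 0 < (q (n k))%:~R :> R by rewrite ltr0z.
have rk : r ^+ n k <= r ^+ k.
  have := n_sqr k; rewrite -mulnn => nk.
  by apply: ler_wiXn2l; [lra|lra|nia].
apply: le_trans rk; rewrite normrM ger0_norm//.
rewrite -(ler_pM2l qR); lra.
Qed.

Lemma sparse_sum_cvg : series sparse_term N @[N --> \oo] --> sparse_sum.
Proof.
apply: normed_cvg.
apply: (@series_le_cvg _ _ (geometric 1 r)) => [k|k|k|].
- exact: normr_ge0.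
- by rewrite /= mul1r exprn_ge0//; lra.
- by rewrite /= mul1r sparse_term_le.
- by apply: is_cvg_geometric_series; rewrite ger0_norm; lra.
Qed.

(** As q m <= q M, a tail below e / q M serves all m <= M at once, so later estimates concern finite
    sums only. *)
Lemma sparse_sum_approx (M : nat) (e : R) : 0 < e -> exists K0 : nat,
  forall K m, (K0 <= K)%N -> (m <= M)%N ->
  `|(q m)%:~R * (sparse_sum - \sum_(k < K) sparse_term k)| <= e.
Proof.
move=> e0.
have qR k : 0 < (q k)%:~R :> R by rewrite ltr0z.
have /cvgrPdist_le/(_ (e / (q M)%:~R)) := sparse_sum_cvg.
rewrite divr_gt0// => /(_ isT)[K0 _ HK0]; exists K0 => K m K0K mM.
have := HK0 K K0K; rewrite /series/= big_mkord ler_pdivlMr//.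
move=> /(le_trans _); apply.
rewrite normrM mulrC ler_wpM2l// gtr0_norm// ler_int.
exact: (homo_leq (@lexx _ _) (@le_trans _ _) q_nondecr).
Qed.

Lemma dist_den_sparse_sum (M : nat) (e : R) : 0 < e -> exists K0 : nat,
  forall K m, (K0 <= K)%N -> (m <= M)%N ->
  dist_nearest_int ((q m)%:~R * sparse_sum) <=
    e + \sum_(k < K) r ^+ gap m (n k).
Proof.
move=> e0; have [K0 HK0] := sparse_sum_approx M e0; exists K0 => K m K0K mM.
have := dist_nearest_int_trans ((q m)%:~R * sparse_sum)
  ((q m)%:~R * \sum_(k < K) sparse_term k) 0.
rewrite subr0 -mulrBr => /le_trans; apply; rewrite addrC lerD ?HK0//.
rewrite mulr_sumr (le_trans (dist_nearest_int_sum _ _ _))//.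
apply: ler_sum => k _; apply: dist_den_mul_err.
by have /andP[] := c_itv k.
Qed.

(** The j-th term contributes at least 1/4, the others at most 2/31 since r^16 <= 1/32, and
    truncation at most 1/32; what remains exceeds 1/8. *)
Lemma dist_den_sparse_sum_ge (j : nat) :
  8^-1 <= dist_nearest_int ((q (n j))%:~R * sparse_sum).
Proof.
have e0 : 0 < 32^-1 :> R by rewrite invr_gt0.
have [K0 HK0] := sparse_sum_approx (n j) e0.
(* Taking K > j keeps the dominant term inside the truncated sum. *)
pose K := maxn K0 j.+1; have Kj : (j < K)%N by rewrite leq_max ltnSn orbT.
have := HK0 K (n j) (leq_maxl _ _) (leqnn _).
rewrite (bigD1 (Ordinal Kj)) //=; set S := \sum_(k < K | _) _ => HS.
have qR : 0 < (q (n j))%:~R :> R by rewrite ltr0z.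
have /andP[cj4 cj2] := c_itv j.
pose y := (q (n j))%:~R * sparse_term j.
have yE : `|y| = (c j)%:R * ((q (n j))%:~R * `|err (n j)|).
  by rewrite !normrM (gtr0_norm qR) ger0_norm// mulrCA.
have dy : dist_nearest_int y = `|y| by rewrite dist_nearest_int_small// yE.
have dS : dist_nearest_int (- ((q (n j))%:~R * S)) <= 2 / 31.
  rewrite dist_nearest_intN mulr_sumr (le_trans (dist_nearest_int_sum _ _ _))//.
  have s01 : 0 <= (32^-1 : R) <= 1 by lra.
  have := sum_expr_gap j K s01; rewrite (bigD1 (Ordinal Kj)) //=.
  rewrite [gap j j](_ : _ = 0)%N ?expr0; last by rewrite /gap subnn.
  set T := \sum_(k < K | _) _ => HT; apply: (@le_trans _ _ T); last by lra.
  apply: ler_sum => k _.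
  apply: le_trans (dist_den_mul_err (n j) (proj2 (andP (c_itv k)))) _.
  apply: (@le_trans _ _ (r ^+ (16 * gap j k))).
    by apply: ler_wiXn2l; [lra|lra|exact: n_gap].
  have r16 : r ^+ 16 <= 32^-1 by rewrite !exprS expr0; lra.
  rewrite exprM; apply: lerXn2r r16; rewrite nnegrE ?exprn_ge0//; lra.
have := dist_nearest_int_trans y
  ((q (n j))%:~R * sparse_sum - (q (n j))%:~R * S) 0.
have := dist_nearest_intD ((q (n j))%:~R * sparse_sum) (- ((q (n j))%:~R * S)).
rewrite subr0 dy yE.
have -> : y - ((q (n j))%:~R * sparse_sum - (q (n j))%:~R * S) =
   - ((q (n j))%:~R * (sparse_sum - (sparse_term j + S))) by rewrite /y; ring.
rewrite normrN.
lra.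
Qed.

Lemma sparse_sum_density (e : R) : 0 < e ->
  natural_density
    [set m | e <= dist_nearest_int ((q m)%:~R * sparse_sum)] (0 : R).
Proof.
(* The constant 50 comes from 1 + 7 k0 + 7 * 7 <= 50 (k0 + 1), the bound reached below for the sum
   of the distances over 1 <= m <= M. *)
move=> e0; apply: (@natural_density_sqrt _ _ (50 / e)) => M k0 Mk0.
rewrite mulrAC ler_pdivlMr// mulrC.
pose f m := dist_nearest_int ((q m)%:~R * sparse_sum).
apply: (@le_trans _ _ (\sum_(m <- iota 1 M) f m)).
  apply: count_markov => m; first exact: dist_nearest_int_ge0.
  by rewrite inE.
(* With truncation error 1 / (M + 1) for each m, the total error stays below 1. *)
have M0 : 0 < M.+1%:R^-1 :> R by rewrite invr_gt0.
have [K HK] := dist_den_sparse_sum M M0.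
have {}HK m := HK K m (leqnn K).
have r0 d : 0 <= r ^+ d by rewrite exprn_ge0//; lra.
have r1 : 0 <= r <= 1 by lra.
(* Here 7 = (1 + r) / (1 - r). *)
have geo j N : \sum_(k < N) r ^+ gap j k <= 7.
  by have := sum_expr_gap j N r1; lra.
have -> : iota 1 M = index_iota 1 M.+1 by rewrite /index_iota subn1.
(* Each of the k0 indices k < k0 costs at most a full geometric series; for k >= k0 the peak n k >=
   k^2 lies at or beyond M, so the cost decays in k - k0. *)
have inner k : \sum_(1 <= m < M.+1) r ^+ gap m (n k) <=
    7 * (k < k0)%N%:R + 7 * r ^+ gap k0 k.
  have sub (g : nat -> nat) :
      \sum_(1 <= m < M.+1) r ^+ g m <= \sum_(m < M.+1) r ^+ g m.
    by rewrite -(big_mkord xpredT (fun m => r ^+ g m)) [leRHS]big_ltn// lerDr.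
  have := sub (fun m => gap m (n k)).
  have [kk0|k0k] := ltnP k k0 => /le_trans subk.
    have {}geo : \sum_(m < M.+1) r ^+ gap m (n k) <= 7.
      by under eq_bigr do rewrite gapC; exact: geo.
    by apply/subk/(le_trans geo); rewrite mulr1; have := r0 (gap k0 k); lra.
  rewrite mulr0 add0r [leRHS]mulrC.
  apply: le_trans (ler_wpM2l (r0 (gap k0 k)) (geo M M.+1)).
  apply: subk; rewrite mulr_sumr; apply: ler_sum => m _.
  (* The gap splits: n k - m >= (k^2 - k0^2) + (M - m) >= (k - k0) + (M - m), using M <= k0^2. *)
  rewrite -exprD; apply: ler_wiXn2l; [lra|lra|].
  have := n_sqr k; have := ltn_ord m; rewrite /gap; nia.
have cnt : \sum_(k < K) (k < k0)%N%:R <= k0%:R :> R.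
  rewrite -natr_sum ler_nat.
  apply: (@leq_trans (minn K k0)); last exact: geq_minr.
  elim: (K) => [|N IHN]; first by rewrite big_ord0.
  rewrite big_ord_recr /=; move: IHN; set S := (\sum_(i < N) _)%N.
  by move: S => S; lia.
apply: (@le_trans _ _
    (1 + \sum_(k < K) (7 * (k < k0)%N%:R + 7 * r ^+ gap k0 k))).
  apply: (@le_trans _ _ (\sum_(1 <= m < M.+1)
      (M.+1%:R^-1 + \sum_(k < K) r ^+ gap m (n k)))).
    rewrite !big_nat; apply: ler_sum => m /andP[_ mM]; exact: HK.
  rewrite big_split/= lerD//; last first.
    by rewrite exchange_big; apply: ler_sum => k _; exact: inner.
  rewrite [leLHS](_ : _ = M%:R / M.+1%:R); last first.
    by rewrite sumr_const_nat subn1 mulr_natl.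
  by rewrite ler_pdivrMr// mul1r ler_nat.
rewrite big_split/= -!mulr_sumr -natr1.
have := geo k0 K; have : 0 <= k0%:R :> R by [].
lra.
Qed.

End Witness.
End SparseSeries.

(** * Unbounded quotients and the strict inclusion *)

Lemma partial_quotient_ge2_infinitely_often
    (R : realType) (alpha : R) (N : nat) :
  ~ (exists M : int, forall n : nat, (0 < n)%N ->
       partial_quotient alpha n <= M) ->
  exists2 n, (N <= n)%N & 2 <= partial_quotient alpha n.+1.
Proof.
move=> unb; apply/not_exists2P => small; apply: unb.
(* Past index N every quotient would be at most 1, so this sum would bound them all. *)
exists (1 + \sum_(i < N.+1) `|partial_quotient alpha i|) => n n_gt0.
have [nN|Nn] := ltnP n N.+1.
  rewrite (bigD1 (Ordinal nN)) //=; set S := \sum_(_ < _ | _) _.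
  have : 0 <= S by exact: sumr_ge0.
  lia.
have [] := small n.-1; first by move=> /negP; lia.
have : 0 <= \sum_(i < N.+1) `|partial_quotient alpha i| by exact: sumr_ge0.
rewrite prednK// => S_ge0 /negP; lia.
Qed.

(** Convergence to 0 leaves only finitely many exceptional indices for each threshold, a set of
    density zero. *)
Lemma char_subgroup_sub_stat (R : realType) (u : nat -> int) :
  char_subgroup R u `<=` stat_char_subgroup R u.
Proof.
move=> x xu e e0; apply: natural_density_finite.
have := circle_norm_cvg0 e0 xu; apply: filterS => n /=.
by rewrite ltNge => /negP.
Qed.

Theorem theorem2p6 (R : realType) (alpha : R)
    (alpha_gt0 : 0 < alpha) (alpha_lt1 : alpha < 1)
    (alpha_irrational : irrational alpha)
    (unbounded_quotients :
       ~ (exists M : int, forall n : nat, (0 < n)%N ->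
            partial_quotient alpha n <= M)) :
  char_subgroup R (convergent_den alpha)
    `<` stat_char_subgroup R (convergent_den alpha).
Proof.
split; first exact: char_subgroup_sub_stat.
pose a := partial_quotient alpha.
have a_gt0 := partial_quotient_gt0 alpha_irrational.
pose q n := shifted_den a n.+2; pose p n := shifted_num a n.+2.
have qE : convergent_den alpha = q by apply/funext => n; exact: convergent_denE.
have q_gt0 n : 0 < q n by exact: shifted_den_gt0.
have q_nondecr n : q n <= q n.+1 by exact: shifted_den_nondecr.
have q_double n : 2 * q n <= q n.+2 by exact: shifted_den_double.
pose err n : R := (q n)%:~R * alpha - (p n)%:~R.
have err_neq0 n : err n != 0 by exact: shifted_err_neq0.
have err_nonincr n : `|err n.+1| <= `|err n| by exact: shifted_err_nonincr.
have err_half n : 2 * `|err n.+2| <= `|err n| by exact: shifted_err_half.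
have [n [n_a n_sqr n_gap]] := exists_sparse_seq 16
  (fun N => partial_quotient_ge2_infinitely_often N unbounded_quotients).
have : forall k, exists c : nat,
    4^-1 <= c%:R * ((q (n k))%:~R * `|err (n k)|) <= 2^-1.
  move=> k; apply: exists_multiple; rewrite den_mul_err_le// andbT.
  by rewrite mulr_gt0 ?ltr0z// normr_gt0.
move=> /choice[c c_itv].
pose x := sparse_sum alpha p q n c.
have normE m : circle_norm ((\pi_(circle R) x) *~ convergent_den alpha m) =
    dist_nearest_int ((q m)%:~R * x).
  by rewrite circle_norm_piMz qE mulrzl.
(* The reverse inclusion would put the class of [x] in the characterized subgroup. *)
move=> sub; have : char_subgroup R (convergent_den alpha) (\pi_(circle R) x).
  apply: sub => e e0; under eq_set do rewrite normE.
  exact: sparse_sum_density.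
move=> x_char; have e0 : 0 < 8^-1 :> R by rewrite invr_gt0.
have [N _ HN] := circle_norm_cvg0 e0 x_char.
(* The index n N >= N^2 >= N falls in the range where the norm should be below 1/8, yet it is at
   least 1/8 there. *)
have nN : (N <= n N)%N by have := n_sqr N; nia.
have := HN _ nN; rewrite /= normE ltNge => /negP; apply.
exact: dist_den_sparse_sum_ge.
Qed.
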